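(* Let $A_1,\ldots,A_8$ be the vertices of an octagon in $\mathbb P^2$, let $\ell_{ij}$ be the line $A_iA_j$, and put $A_9=A_1$. Set $P_1=\ell_{18}\cap\ell_{23}$, $P_2=\ell_{12}\cap\ell_{34}$, $P_3=\ell_{23}\cap\ell_{45}$, $P_4=\ell_{34}\cap\ell_{56}$, and for $i=1,\ldots,4$ let $\gamma_i$ be the conic through $A_i,A_{i+1},A_{4+i},A_{5+i},P_i$. If the octagon is circumscribed to an irreducible conic $\gamma$, then the eight points $(\gamma_1\cap\gamma_3)\cup(\gamma_2\cap\gamma_4)$ are on a conic.
   Context: Work in the projective plane $\mathbb P^2$ over $\mathbb C$. The sides of the octagon are the eight lines $\ell_{12},\ell_{23},\ell_{34},\ell_{45},\ell_{56},\ell_{67},\ell_{78},\ell_{18}$. The octagon is circumscribed to $\gamma$ if these eight sides are distinct lines tangent to $\gamma$. *)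

(* Defs.v *)
From HB Require Import structures.
From mathcomp Require Import all_boot all_order all_algebra.
From mathcomp Require Import reals complex mpoly.

Set Implicit Arguments.
Unset Strict Implicit.
Unset Printing Implicit Defensive.

Import GRing.Theory.
Local Open Scope ring_scope.

(* A point of the projective plane is given by homogeneous coordinates; two   *)
(* such vectors p and q stand for the same point when they span the same line *)
(* of K^3, i.e. when (p == q)%MS.  Accordingly, projective lines are          *)
(* two-dimensional row spaces, up to equality of row spaces.                  *)
Record point (K : fieldType) := ProjPoint {
  coords :> 'rV[K]_3;
  coords_neq0 : coords != 0
}.

(* A conic is a nonzero ternary quadratic form; it may be reducible. *)
Record conic (K : fieldType) := Conic {
  form :> {mpoly K[3]};
  form_neq0 : form != 0;
  form_homog : form \is 2.-homog
}.

Section ProjectivePlane.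
Variable K : fieldType.
Implicit Types (p q x : point K) (l m : 'M[K]_3) (F : conic K).

Definition line p q : 'M[K]_3 := (p + q)%MS.

Definition is_meet x l m := (x == (l :&: m))%MS.

Definition on_conic F x := meval (coords x 0) (form F) = 0.

Definition irreducible_conic F :=
  forall g h : {mpoly K[3]},
    form F = g * h -> g \is a GRing.unit \/ h \is a GRing.unit.

Definition gradient F x : 'rV[K]_3 :=
  \row_(i < 3) meval (coords x 0) (mderiv i (form F)).

(* The row space of kermx (gradient F x)^T is the set of all u such that      *)
(* \sum_i (dF/dX_i)(x) u_i = 0, that is, the tangent line of F at x.          *)
Definition tangent l F :=
  exists x, [/\ on_conic F x, gradient F x != 0 &
                (l == kermx (gradient F x)^T)%MS].

(* Vertices are indexed modulo 8, so that A 9 is A 1 and A 8 is A 0. *)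
Definition octagon (A : 'Z_8 -> point K) :=
  forall i, ~~ (A i == A (i + 1)%R)%MS.

Definition side (A : 'Z_8 -> point K) (i : 'Z_8) := line (A i) (A (i + 1)).

Definition circumscribed (A : 'Z_8 -> point K) F :=
  (forall i j, i != j -> ~~ (side A i == side A j)%MS)
  /\ (forall i, tangent (side A i) F).

End ProjectivePlane.

(* Main.v *)
(** The points of the plane are the unordered pairs {x, y} of points of P^1,
    so that the tangents of gamma are the lines {z, _} and the vertex between
    two sides z, z' is {z, z'}.  With side i written z_i, gamma_1 passes through
    the vertices of the triangles with sides z_8, z_1, z_2 and z_4, z_5, z_6;
    it is therefore unique, and equal to the zero set of the Bezoutian of the
    two binary cubics vanishing at these triples.  Likewise for the other three
    conics, by cyclic shifts.  The four Bezoutians satisfy one linear relation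
    [z_3 z_7] B_1 + [z_4 z_8] B_2 + [z_5 z_1] B_3 + [z_6 z_2] B_4 = 0, so the
    conic [z_3 z_7] B_1 + [z_5 z_1] B_3 contains all eight points. *)
Require Import Defs.
From HB Require Import structures.
From mathcomp Require Import all_boot all_order all_algebra.
From mathcomp Require Import reals complex mpoly.
From mathcomp Require Import ring zify.

Set Implicit Arguments.
Unset Strict Implicit.
Unset Printing Implicit Defensive.

Import GRing.Theory.
Local Open Scope ring_scope.

(** * Binary forms: pairs of points of the projective line and Bezoutians of cubics *)

Section BinaryForms.
Variable K : fieldType.
Implicit Types (a b c d e f x y : K * K) (u v w : 'rV[K]_3).

Definition bracket x y : K := x.1 * y.2 - x.2 * y.1.

(* In the coordinates (x1 y1, x1 y2 + x2 y1, x2 y2) of the pair {x, y}, the line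
   of all pairs containing x. *)
Definition ell x v : K :=
  v 0 0 * x.2 ^+ 2 - v 0 1 * (x.1 * x.2) + v 0 2%:R * x.1 ^+ 2.

Definition bipoint x y : 'rV[K]_3 :=
  \row_(i < 3) nth 0 [:: x.1 * y.1; x.1 * y.2 + x.2 * y.1; x.2 * y.2] i.

(* Coefficients, up to sign, of the binary cubic with roots a, b and c. *)
Definition cubic a b c : seq K :=
  [:: a.1 * b.1 * c.1;
      a.2 * b.1 * c.1 + a.1 * b.2 * c.1 + a.1 * b.1 * c.2;
      a.1 * b.2 * c.2 + a.2 * b.1 * c.2 + a.2 * b.2 * c.1;
      a.2 * b.2 * c.2].

(* (f(x) g(y) - f(y) g(x)) / [x y] up to sign, where f and g are the cubics with
   roots a, b, c and d, e, f, as a quadratic form in the coordinates v of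
   {x, y}. *)
Definition bezout a b c d e f v : K :=
  let m i j := (cubic a b c)`_i * (cubic d e f)`_j
               - (cubic a b c)`_j * (cubic d e f)`_i in
  m 0 1 * v 0 2%:R ^+ 2 - m 0 2 * (v 0 1 * v 0 2%:R)
  + m 0 3 * (v 0 1 ^+ 2 - v 0 0 * v 0 2%:R) + m 1 2 * (v 0 0 * v 0 2%:R)
  - m 1 3 * (v 0 0 * v 0 1) + m 2 3 * v 0 0 ^+ 2.

(** Let p and q be the cubics with roots a, b, c and d, e, f, and expand q / p in partial fractions.
    A multiple of p in q drops out of the Bezoutian, and the pole a contributes q(a) times the
    product of the lines [ell b] and [ell c], up to a constant. *)
Lemma bezout_lagrange a b c d e f v :
  bracket a b * bracket b c * bracket a c * bezout a b c d e f v =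
  bracket b c * (bracket a d * bracket a e * bracket a f) * (ell b v * ell c v)
  - bracket a c * (bracket b d * bracket b e * bracket b f)
    * (ell a v * ell c v)
  + bracket a b * (bracket c d * bracket c e * bracket c f)
    * (ell a v * ell b v).
Proof. rewrite /bezout /cubic /= /ell /bracket; ring. Qed.

(** Let each letter also denote its linear form. Up to sign, [c g][x y] is c(x) g(y) - c(y) g(x).
    Hence the first term times [x y]^2 is T(habc) - T(ghab), where T(habc) is habc(x) defg(y)
    symmetrized in x and y. The other terms are cyclic shifts of it, so the sum telescopes to
    T(cdef) - T(ghab), which is 0 because these blocks are complementary. *)
Lemma bezout_octagon a b c d e f g h v :
  bracket c g * bezout h a b d e f v + bracket d h * bezout a b c e f g v
  + bracket e a * bezout b c d f g h v + bracket f b * bezout c d e g h a v = 0.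
Proof. rewrite /bezout /cubic /= /bracket; ring. Qed.

Lemma ell_bipoint x a b : ell x (bipoint a b) = bracket a x * bracket b x.
Proof. by rewrite /ell /bracket !mxE /=; ring. Qed.

Lemma ellZ x k v : ell x (k *: v) = k * ell x v.
Proof. by rewrite /ell !mxE; ring. Qed.

Lemma ord3P (i : 'I_3) : [\/ i = 0, i = 1 | i = 2%:R].
Proof.
by case: i => [[|[|[|//]]] ?]; [apply: Or31 | apply: Or32 | apply: Or33];
  apply/val_inj.
Qed.

Lemma row3P u v :
  u 0 0 = v 0 0 -> u 0 1 = v 0 1 -> u 0 2%:R = v 0 2%:R -> u = v.
Proof. by move=> h0 h1 h2; apply/rowP => i; case: (ord3P i) => ->. Qed.

Lemma ell_meet a b v :
  bracket a b != 0 -> v != 0 -> ell a v = 0 -> ell b v = 0 ->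
  exists2 k, k != 0 & v = k *: bipoint a b.
Proof.
move=> ab0 v0 av bv.
have cross (i j : 'I_3) : v 0 i * bipoint a b 0 j = v 0 j * bipoint a b 0 i.
  suff H : v 0 0 * bipoint a b 0 1 = v 0 1 * bipoint a b 0 0 /\
           v 0 0 * bipoint a b 0 2%:R = v 0 2%:R * bipoint a b 0 0 /\
           v 0 1 * bipoint a b 0 2%:R = v 0 2%:R * bipoint a b 0 1.
    by case: H => H1 [H2 H3]; case: (ord3P i) => ->; case: (ord3P j) => ->.
  (* Times [a b], each 2 by 2 minor is a combination of the two line equations. *)
  split; [|split]; apply: (mulfI ab0); apply/eqP; rewrite -subr_eq0; apply/eqP.
  - transitivity (a.1 ^+ 2 * ell b v - b.1 ^+ 2 * ell a v).
      by rewrite !mxE /ell /bracket /=; ring.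
    by rewrite av bv !mulr0 subr0.
  - transitivity (a.1 * a.2 * ell b v - b.1 * b.2 * ell a v).
      by rewrite !mxE /ell /bracket /=; ring.
    by rewrite av bv !mulr0 subr0.
  - transitivity (a.2 ^+ 2 * ell b v - b.2 ^+ 2 * ell a v).
      by rewrite !mxE /ell /bracket /=; ring.
    by rewrite av bv !mulr0 subr0.
have w0 : bipoint a b != 0.
  apply: contraNneq ab0 => w0.
  (* The discriminant of the binary quadratic form with roots a and b is [a b]^2. *)
  have /eqP : bracket a b ^+ 2 = 0.
    transitivity (bipoint a b 0 1 ^+ 2
                  - 4%:R * (bipoint a b 0 0 * bipoint a b 0 2%:R)).
      by rewrite !mxE /bracket /=; ring.
    by rewrite w0 !mxE; ring.
  by rewrite expf_eq0.
have [i wi] := rV0Pn _ w0.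
have Ev : v = (v 0 i / bipoint a b 0 i) *: bipoint a b.
  by apply/rowP => j; rewrite mxE mulrAC cross mulfK.
exists (v 0 i / bipoint a b 0 i) => //.
by apply: contraNneq v0 => k0; rewrite Ev k0 scale0r.
Qed.

(** The vertices of a triangle of tangents form a basis in which the opposite sides are the
    coordinate functions, up to scalars; denominators are cleared. *)
Lemma bipoint_span a b c v :
  (bracket a b * bracket b c * bracket a c) *: v =
  (bracket b c * ell a v) *: bipoint b c
  + (- (bracket a c * ell b v)) *: bipoint a c
  + (bracket a b * ell c v) *: bipoint a b.
Proof. by apply: row3P; rewrite !mxE /bracket /ell /=; ring. Qed.

(** The value at [v] certifies that a is not (0, 0). Then b is a multiple t a, and [ell b] is t^2
    times [ell a]. *)
Lemma ell_bracket0 (a b : K * K) u v :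
  bracket a b = 0 -> ell a u = 0 -> ell a v != 0 -> ell b u = 0.
Proof.
move=> ab au av; apply/eqP.
have : (a.1 == 0) && (a.2 == 0) = false.
  apply: contraNF av => /andP[/eqP a1 /eqP a2].
  by rewrite /ell a1 a2 !(expr0n, mul0r, mulr0) addr0 subr0.
apply: contraFT => bu.
have sq0 k : k ^+ 2 * ell b u = 0 -> k == 0.
  by move/eqP; rewrite mulf_eq0 sqrf_eq0 (negbTE bu) orbF.
apply/andP; split; apply: sq0.
  transitivity (b.1 ^+ 2 * ell a u + bracket a b
      * (u 0 0 * (a.1 * b.2 + a.2 * b.1) - u 0 1 * (a.1 * b.1))).
    by rewrite /ell /bracket; ring.
  by rewrite au ab mulr0 mul0r addr0.
transitivity (b.2 ^+ 2 * ell a u + bracket a b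
    * (u 0 1 * (a.2 * b.2) - u 0 2%:R * (a.1 * b.2 + a.2 * b.1))).
  by rewrite /ell /bracket; ring.
by rewrite au ab mulr0 mul0r addr0.
Qed.

End BinaryForms.

(** * Symmetric bilinear forms in dimension 3 and their isotropic vectors *)

Section Bilinear.
Variables (K : fieldType) (S : 'M[K]_3).
Hypothesis S_sym : S^T = S.
Implicit Types u v w : 'rV[K]_3.

Definition bil u v : K := (u *m S *m v^T) 0 0.

Lemma bilC u v : bil u v = bil v u.
Proof.
transitivity ((v *m S *m u^T)^T 0 0); last by rewrite mxE.
by rewrite !trmx_mul trmxK S_sym mulmxA.
Qed.

Lemma bilDl u v w : bil (u + v) w = bil u w + bil v w.
Proof. by rewrite /bil !mulmxDl mxE. Qed.

Lemma bilZl k u w : bil (k *: u) w = k * bil u w.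
Proof. by rewrite /bil -!scalemxAl mxE. Qed.

Lemma bilDr u v w : bil w (u + v) = bil w u + bil w v.
Proof. by rewrite bilC bilDl !(bilC _ w). Qed.

Lemma bilZr k u w : bil w (k *: u) = k * bil w u.
Proof. by rewrite bilC bilZl (bilC _ w). Qed.

(** Five vertices determine the conic. Those of the first triangle leave three unknown coefficients;
    the vertices {d, e} and {e, f} give two linear equations, solved by the coefficients in
    [bezout_lagrange]. *)
Lemma two_triangles (a b c d e f : K * K) (vab vbc vac vde vef : 'rV[K]_3) :
  bracket a b != 0 -> bracket b c != 0 -> bracket a c != 0 ->
  bracket a d != 0 -> bracket a e != 0 -> bracket a f != 0 ->
  bracket b e != 0 -> bracket c e != 0 ->
  bracket d e != 0 -> bracket e f != 0 -> bracket d f != 0 ->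
  vab != 0 -> ell a vab = 0 -> ell b vab = 0 -> bil vab vab = 0 ->
  vbc != 0 -> ell b vbc = 0 -> ell c vbc = 0 -> bil vbc vbc = 0 ->
  vac != 0 -> ell a vac = 0 -> ell c vac = 0 -> bil vac vac = 0 ->
  vde != 0 -> ell d vde = 0 -> ell e vde = 0 -> bil vde vde = 0 ->
  vef != 0 -> ell e vef = 0 -> ell f vef = 0 -> bil vef vef = 0 ->
  exists mu, forall v, bil v v = mu * bezout a b c d e f v.
Proof.
move=> ab bc ac ad ae af be ce de ef df.
have bip x y v : bracket x y != 0 -> v != 0 -> ell x v = 0 -> ell y v = 0 ->
    bil v v = 0 -> bil (bipoint x y) (bipoint x y) = 0.
  move=> xy v0 xv yv; have [k k0 ->] := ell_meet xy v0 xv yv.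
  by rewrite bilZl bilZr => /eqP; rewrite !mulf_eq0 (negbTE k0) => /eqP.
move=> n1 h1 k1 /(bip _ _ _ ab n1 h1 k1) qab.
move=> n2 h2 k2 /(bip _ _ _ bc n2 h2 k2) qbc.
move=> n3 h3 k3 /(bip _ _ _ ac n3 h3 k3) qac.
move=> n4 h4 k4 /(bip _ _ _ de n4 h4 k4) qde.
move=> n5 h5 k5 /(bip _ _ _ ef n5 h5 k5) qef.
pose V := bracket a b * bracket b c * bracket a c.
have V0 : V != 0 by rewrite !mulf_neq0.
(* Modulo the values at the vertices of the first triangle, only the products of
   two of its sides survive. *)
have [[[al be'] ga] /= q] : exists abc : K * K * K, forall v,
    bil v v = abc.1.1 * (ell b v * ell c v) + abc.1.2 * (ell a v * ell c v)
              + abc.2 * (ell a v * ell b v).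
  (* These are the cross terms, each occurring twice, when [V *: v] is expanded by
     [bipoint_span]. *)
  exists (- (2%:R * bracket a c * bracket a b
             * bil (bipoint a c) (bipoint a b) / V ^+ 2),
          2%:R * bracket b c * bracket a b
             * bil (bipoint b c) (bipoint a b) / V ^+ 2,
          - (2%:R * bracket b c * bracket a c
             * bil (bipoint b c) (bipoint a c) / V ^+ 2)) => v /=.
  have V20 : V ^+ 2 != 0 by rewrite expf_neq0.
  apply: (mulfI V20).
  transitivity (bil (V *: v) (V *: v)).
    by rewrite bilZl bilZr; ring.
  rewrite bipoint_span !bilDl !bilDr !bilZl !bilZr qab qbc qac.
  rewrite (bilC (bipoint a c) (bipoint b c)) (bilC (bipoint a b) (bipoint b c)).
  rewrite (bilC (bipoint a b) (bipoint a c)).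
  by move: V20; set W := V ^+ 2 => W0; field.
have := q (bipoint d e); rewrite qde !ell_bipoint => e1.
have := q (bipoint e f); rewrite qef !ell_bipoint => e2.
(* Eliminating [ga] from the equations at {d, e} and {e, f} leaves, by the three-term relation
   between brackets, the common factor [d f][c e]. Eliminating [be'] in [Hc] leaves [d f][b e]. *)
have Hb : be' * (bracket b c * (bracket d a * bracket e a * bracket f a)) =
          - (al * (bracket a c * (bracket d b * bracket e b * bracket f b))).
  have nz : bracket d f * bracket c e != 0 by rewrite mulf_neq0.
  apply: (mulfI nz); apply/eqP; rewrite -subr_eq0; apply/eqP.
  have := congr2 (fun x y => bracket f a * bracket f b * x
                             - bracket d a * bracket d b * y) e1 e2.
  rewrite /= !mulr0 subr0 => E; rewrite [RHS]E.
  by rewrite /bracket; ring.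
have Hc : ga * (bracket b c * (bracket d a * bracket e a * bracket f a)) =
          al * (bracket a b * (bracket d c * bracket e c * bracket f c)).
  have nz : bracket d f * bracket b e != 0 by rewrite mulf_neq0.
  apply: (mulfI nz); apply/eqP; rewrite -subr_eq0; apply/eqP.
  have := congr2 (fun x y => bracket d a * bracket d c * y
                             - bracket f a * bracket f c * x) e1 e2.
  rewrite /= !mulr0 subr0 => E; rewrite [RHS]E.
  by rewrite /bracket; ring.
have g0 : bracket b c * (bracket d a * bracket e a * bracket f a) != 0.
  have anti x : bracket x a = - bracket a x by rewrite /bracket; ring.
  by rewrite !anti !(mulrN, mulNr, oppr_eq0) !mulf_neq0.
(* The scalar is read off from [ell b v * ell c v], whose coefficient in [bezout_lagrange] is -
   [g]. *)
set g := bracket b c * _ in Hb Hc g0; exists (- (al * V / g)) => v.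
apply: (mulfI g0); transitivity (- (al * (V * bezout a b c d e f v))).
  rewrite /V bezout_lagrange q.
  transitivity (al * g * (ell b v * ell c v) + be' * g * (ell a v * ell c v)
                + ga * g * (ell a v * ell b v)); first by ring.
  by rewrite Hb Hc /g /bracket; ring.
by field.
Qed.

Lemma bil_kermx u x : (u <= kermx (x *m S)^T)%MS = (bil u x == 0).
Proof.
rewrite sub_kermx trmx_mul S_sym mulmxA; apply/eqP/eqP => [E|E].
  by rewrite /bil E mxE.
by apply/matrixP => i j; rewrite !ord1 -[LHS]/(bil u x) E mxE.
Qed.

Lemma kermxS_tr m n (A : 'M[K]_(m, 3)) (B : 'M[K]_(n, 3)) :
  (B <= A)%MS -> (kermx A^T <= kermx B^T)%MS.
Proof.
by case/submxP => D ->; rewrite sub_kermx trmx_mul mulmxA mulmx_ker mul0mx.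
Qed.

(* The tangent covectors xS and yS both annihilate x and y. *)
Lemma isotropic_tangents x y :
  bil x x = 0 -> bil y y = 0 -> bil x y = 0 -> x *m S != 0 -> y *m S != 0 ->
  (kermx (x *m S)^T == kermx (y *m S)^T)%MS.
Proof.
move=> xx yy xy x0 y0; pose X := col_mx x y.
have XSX : X *m S *m X^T = 0.
  rewrite mul_col_mx tr_col_mx mul_col_row.
  have z u v : bil u v = 0 -> u *m S *m v^T = 0.
    by move=> E; apply/matrixP => i j; rewrite !ord1 -[LHS]/(bil u v) E mxE.
  by rewrite !z ?block_mx0 // bilC.
(* The ranks of X S and X add up to at most 3, and the first is at most the second. *)
have rX : (\rank (X *m S) <= 1)%N.
  have := mulmx0_rank_max XSX; rewrite mxrank_tr => le3.
  have := mxrankM_maxl X S; lia.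
have sub u : (u <= X *m S)%MS -> u != 0 -> (X *m S <= u)%MS.
  move=> uX u0; rewrite -(geq_leqif (mxrank_leqif_sup uX)).
  by apply: leq_trans rX _; rewrite lt0n mxrank_eq0.
have XS : X *m S = col_mx (x *m S) (y *m S) by rewrite mul_col_mx.
have xX : (x *m S <= X *m S)%MS by rewrite XS -addsmxE addsmxSl.
have yX : (y *m S <= X *m S)%MS by rewrite XS -addsmxE addsmxSr.
by rewrite !kermxS_tr // (submx_trans xX, submx_trans yX) ?sub.
Qed.

(** * Coordinates from two tangents: x and y are the points of contact, w is where the tangents
    meet *)

Section Basis.
Variables x y w : 'rV[K]_3.
Hypotheses (xx : bil x x = 0) (yy : bil y y = 0) (xw : bil x w = 0)
  (yw : bil y w = 0) (xy : bil x y != 0) (w0 : w != 0).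

Let wx : bil w x = 0. Proof. by rewrite bilC. Qed.
Let wy : bil w y = 0. Proof. by rewrite bilC. Qed.
Let yx : bil y x = bil x y. Proof. by rewrite bilC. Qed.

(** In a vanishing combination of x, y, w, pairing with y and x kills the first two coefficients,
    and then w != 0 kills the third. *)
Lemma isotropic_span v : exists abc : K * K * K,
  v = abc.1.1 *: x + abc.1.2 *: y + abc.2 *: w.
Proof.
pose T : 'M[K]_3 := \matrix_(i < 3) nth 0 [:: x; y; w] i.
have TE (u : 'rV_3) : u *m T = u 0 0 *: x + u 0 1 *: y + u 0 2%:R *: w.
  rewrite mulmx_sum_row !big_ord_recl big_ord0 !rowK /= addr0 addrA.
  by congr (_ *: _ + _ *: _ + _ *: _); congr (u _ _); exact/val_inj.
have Tfree : row_free T.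
  apply: inj_row_free => u; rewrite TE => E.
  have := congr1 (bil x) E; have := congr1 (bil y) E.
  rewrite !bilDr !bilZr xx yy xw yw yx.
  have -> : (0 : 'rV[K]_3) = 0 *: x by rewrite scale0r.
  rewrite !bilZr !mul0r !mulr0 !addr0 !add0r => /eqP.
  rewrite mulf_eq0 (negbTE xy) orbF => /eqP u0 /eqP.
  rewrite mulf_eq0 (negbTE xy) orbF => /eqP u1.
  move: E; rewrite u0 u1 !scale0r !add0r => /eqP.
  rewrite scaler_eq0 (negbTE w0) orbF => /eqP u2.
  by apply: row3P; rewrite mxE.
have /submxP [D ->] : (v <= T)%MS.
  by rewrite submx_full // row_full_unit -row_free_unit.
by exists (D 0 0, D 0 1, D 0 2%:R); rewrite TE.
Qed.

(** Here w lies in the radical, so the form degenerates to a product of two linear forms;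
    irreducibility of gamma will exclude this. *)
Lemma isotropic_split : bil w w = 0 ->
  forall v, bil v v = 2%:R / bil x y * (bil v x * bil v y).
Proof.
move=> ww v; have [[[a b] c] ->] := isotropic_span v.
rewrite /= !bilDl !bilDr !bilZl !bilZr xx yy xw yw wx wy yx ww.
by field.
Qed.

Hypothesis ww : bil w w != 0.
Hypothesis two0 : (2%:R : K) != 0.

(* Isotropic vectors satisfy ab = k c^2, hence are proportional to
   (s^2, k t^2, s t) in the basis x, y, w; M absorbs this change of basis. *)
Lemma isotropic_param : exists2 M : 'M[K]_3, M \in unitmx &
  forall v, bil v v = 0 -> v *m S != 0 -> exists z : K * K,
    exists2 k, k != 0 & forall u, bil u v = k * ell z (u *m M).
Proof.
pose k := - bil w w / (2%:R * bil x y).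
have k0 : k != 0 by rewrite mulf_neq0 ?oppr_eq0 ?invr_eq0 ?mulf_neq0.
(* With these columns, u M is ([bil u x], - [bil u w], k [bil u y]), so pairing u with s^2 x + k t^2
   y + s t w gives [ell (t, s)] at u M. *)
pose n (i : nat) := nth 0 [:: x; - w; k *: y] i.
pose M : 'M[K]_3 := \matrix_(i, j) (S *m (n j)^T) i 0.
have ME u (j : 'I_3) : (u *m M) 0 j = bil u (n j).
  rewrite /bil -mulmxA !mxE; apply: eq_bigr => i _.
  by rewrite !mxE.
have bilN u v : bil u (- v) = - bil u v.
  by rewrite -scaleN1r bilZr mulN1r.
exists M.
  rewrite -row_free_unit; apply: inj_row_free => u uM.
  have := ME u 0; have := ME u 1; have := ME u 2%:R.
  rewrite uM !mxE /n /= bilN bilZr => /esym/eqP.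
  rewrite mulf_eq0 (negbTE k0) => /eqP uy /esym/eqP.
  rewrite oppr_eq0 => /eqP uw /esym ux.
  have [[[a b] c] /= E] := isotropic_span u.
  move: ux uy uw; rewrite E !bilDl !bilZl xx yy xw yw wx wy yx.
  rewrite !mulr0 !addr0 !add0r.
  move=> /eqP; rewrite mulf_eq0 (negbTE xy) orbF => /eqP ->.
  move=> /eqP; rewrite mulf_eq0 (negbTE xy) orbF => /eqP ->.
  move=> /eqP; rewrite mulf_eq0 (negbTE ww) orbF => /eqP ->.
  by rewrite !scale0r !addr0.
move=> v; have [[[a b] c] /= ->] := isotropic_span v.
rewrite !bilDl !bilDr !bilZl !bilZr xx yy xw yw wx wy yx => q v0.
have abc : a * b = k * c ^+ 2.
  apply: (mulfI two0); apply: (mulIf xy); apply/eqP; rewrite -subr_eq0.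
  rewrite -[X in _ == X]q; apply/eqP; rewrite /k; field.
  by rewrite xy two0.
have [a0|a0] := eqVneq a 0.
  (* This is the parameter s = 0: the vector is a multiple of y. *)
  have /eqP : k * c ^+ 2 = 0 by rewrite -abc a0 mul0r.
  rewrite mulf_eq0 (negbTE k0) expf_eq0 /= => /eqP c0.
  move: v0; rewrite a0 c0 !scale0r add0r addr0 => v0.
  have b0 : b != 0 by apply: contraNneq v0 => ->; rewrite scale0r mul0mx.
  exists (1, 0), (b / k); first by rewrite mulf_neq0 ?invr_eq0.
  move=> u; rewrite /ell !ME /n /= !bilZr; field.
  exact: k0.
(* Take s = a and t = c: since a b = k c^2, a times the vector is a^2 x + k c^2 y + a c w. *)
exists (c, a), a^-1; first by rewrite invr_eq0.
move=> u; rewrite /ell !ME /n /= bilN !bilDr !bilZr.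
apply: (mulfI a0); rewrite [RHS]mulrA mulfV // mul1r.
transitivity (a ^+ 2 * bil u x + a * b * bil u y + c * a * bil u w).
  by ring.
by rewrite abc; ring.
Qed.
End Basis.
End Bilinear.

(** * Conics as polynomials and as symmetric matrices *)

Section Quadrics.
Variable K : fieldType.

Definition quadric (S : 'M[K]_3) : {mpoly K[3]} :=
  \sum_i \sum_j S i j *: ('X_i * 'X_j).

Lemma quadricD S T : quadric (S + T) = quadric S + quadric T.
Proof.
rewrite /quadric -big_split; apply: eq_bigr => i _.
by rewrite -big_split; apply: eq_bigr => j _; rewrite mxE scalerDl.
Qed.

Lemma quadricZ k S : quadric (k *: S) = k *: quadric S.
Proof.
rewrite /quadric scaler_sumr; apply: eq_bigr => i _.
by rewrite scaler_sumr; apply: eq_bigr => j _; rewrite mxE scalerA.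
Qed.

Lemma quadric0 : quadric 0 = 0.
Proof. by rewrite -(scale0r (0 : 'M_3)) quadricZ scale0r. Qed.

Lemma quadric_tr S : quadric S^T = quadric S.
Proof.
rewrite /quadric exchange_big; apply: eq_bigr => i _; apply: eq_bigr => j _.
by rewrite mxE mulrC.
Qed.

Lemma quadric_delta i j : quadric (delta_mx i j) = 'X_i * 'X_j.
Proof.
rewrite /quadric (bigD1 i) //= (bigD1 j) //= mxE !eqxx scale1r.
rewrite !big1 ?addr0 // => [k ki|k kj].
  by apply: big1 => l _; rewrite mxE (negbTE ki) scale0r.
by rewrite mxE (negbTE kj) andbF scale0r.
Qed.

Lemma meval_quadric S (v : 'rV[K]_3) : (quadric S).@[v 0] = bil S v v.
Proof.
rewrite /quadric raddf_sum /bil -mulmxA mxE; apply: eq_bigr => i _.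
rewrite raddf_sum mxE mulr_sumr; apply: eq_bigr => j _ /=.
by rewrite mevalZ mevalM !mevalXU mxE; ring.
Qed.

Lemma mderivXU (i k : 'I_3) : ('X_i : {mpoly K[3]})^`M(k) = (i == k)%:R.
Proof.
rewrite mderivX mnmE eq_sym; have [->|_] := eqVneq k i; last by rewrite scale0r.
by rewrite scale1r -{1}[U_(_)%MM]add0m addmK mpolyX0.
Qed.

Lemma gradient_quadric (S : 'M[K]_3) (v : 'rV[K]_3) : S^T = S ->
  \row_k ((quadric S)^`M(k)).@[v 0] = 2%:R *: (v *m S).
Proof.
move=> S_sym; apply/rowP => k; rewrite !mxE /quadric.
transitivity (\sum_i \sum_j ((i == k)%:R * (S i j * v 0 j)
                            + (j == k)%:R * (S i j * v 0 i))).
  rewrite (raddf_sum (mderiv k)) (raddf_sum (meval (v 0))).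
  apply: eq_bigr => i _ /=.
  rewrite (raddf_sum (mderiv k)) (raddf_sum (meval (v 0))).
  apply: eq_bigr => j _ /=; rewrite mderivZ mevalZ mderivM mevalD !mevalM.
  by rewrite !mderivXU !mevalXU !rmorph_nat; ring.
have sum_delta (f : 'I_3 -> K) : \sum_i (i == k)%:R * f i = f k.
  rewrite (bigD1 k) //= eqxx mul1r big1 ?addr0 // => i /negbTE ->.
  by rewrite mul0r.
under eq_bigr do rewrite big_split /= -mulr_sumr sum_delta.
rewrite big_split /= sum_delta mulr_natl mulr2n; congr (_ + _).
  by apply: eq_bigr => i _; rewrite -{1}S_sym mxE mulrC.
by apply: eq_bigr => i _; rewrite mulrC.
Qed.

Hypothesis two0 : (2%:R : K) != 0.

Lemma dhomog2_quadric (F : {mpoly K[3]}) : F \is 2.-homog ->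
  exists2 S, S^T = S & F = quadric S.
Proof.
move=> /dhomogP F2; suff [S ->] : exists S, F = quadric S.
  (* Any coefficient matrix may be replaced by its symmetric part. *)
  exists (2%:R^-1 *: (S + S^T)).
    by apply/matrixP => i j; rewrite !mxE addrC.
  rewrite quadricZ quadricD quadric_tr -mulr2n -scaler_nat scalerA.
  by rewrite mulVf ?scale1r.
rewrite (mpolyE F) big_seq.
elim/big_ind: _ => [|_ _ [S ->] [T ->]|m mF].
- by exists 0; rewrite quadric0.
- by exists (S + T); rewrite quadricD.
have m2 : mdeg m = 2%N := F2 m mF.
have [i mi] : exists i, m i != 0%N.
  apply/existsP; apply: contra_eqT m2; rewrite negb_exists => /forallP m0.
  by rewrite mdegE big1 // => i _; apply/eqP; rewrite -[_ == _]negbK.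
have Em : m = (m - U_(i) + U_(i))%MM.
  rewrite submK //; apply/mnm_lepP => k; rewrite mnmE.
  by case: eqVneq => // <-; rewrite lt0n.
have /mdeg1P [j /eqP Ej] : mdeg (m - U_(i)) == 1%N.
  by move: m2; rewrite {1}Em mdegD mdeg1 => /eqP; rewrite addn1 eqSS.
exists (F@_m *: delta_mx j i).
by rewrite quadricZ quadric_delta -mpolyXD -Ej -Em.
Qed.

Lemma bil_eq0 (S : 'M[K]_3) : S^T = S -> (forall v, bil S v v = 0) -> S = 0.
Proof.
move=> S_sym S0; apply/matrixP => i j.
have Sij : S i j = bil S (delta_mx 0 i) (delta_mx 0 j).
  by rewrite /bil -rowE trmx_delta -colE !mxE.
have := S0 (delta_mx 0 i + delta_mx 0 j).
rewrite bilDl !(bilDr S_sym) !S0 addr0 add0r (bilC S_sym (delta_mx 0 j)).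
rewrite -Sij -mulr2n -mulr_natl => /eqP.
by rewrite mulf_eq0 (negbTE two0) mxE => /eqP.
Qed.

Lemma dhomog2_eq0 (F : {mpoly K[3]}) : F \is 2.-homog ->
  (forall v : 'rV_3, F.@[v 0] = 0) -> F = 0.
Proof.
case/dhomog2_quadric => S S_sym -> S0.
rewrite (bil_eq0 S_sym) => [|v]; last by rewrite -meval_quadric.
by rewrite quadric0.
Qed.

Definition linform (c : 'cV[K]_3) : {mpoly K[3]} := \sum_i c i 0 *: 'X_i.

Lemma meval_linform c (v : 'rV_3) : (linform c).@[v 0] = (v *m c) 0 0.
Proof.
rewrite raddf_sum mxE; apply: eq_bigr => i _ /=.
by rewrite mevalZ mevalXU mulrC.
Qed.

Lemma linform_homog c : linform c \is 1.-homog.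
Proof.
by apply: rpred_sum => i _; apply: dhomogZ; rewrite dhomogX /= mdeg1.
Qed.

Lemma linform_nonunit c : linform c \isn't a GRing.unit.
Proof.
apply/negP => /(rmorph_unit (meval ((0 : 'rV[K]_3) 0))) /=.
by rewrite meval_linform mul0mx mxE unitr0.
Qed.

(** Quadratic forms with equal values are equal polynomials, so F would be a product of two linear
    forms, which are not units. *)
Lemma irreducible_conic_bil (F : conic K) (S : 'M[K]_3) (k : K) (c d : 'cV_3) :
  Defs.form F = quadric S -> irreducible_conic F ->
  ~ (forall v, bil S v v = k * ((v *m c) 0 0 * (v *m d) 0 0)).
Proof.
move=> FS Firr E.
have : Defs.form F = linform (k *: c) * linform d.
  apply/eqP; rewrite -subr_eq0; apply/eqP; apply: dhomog2_eq0.
    rewrite rpredB ?form_homog //.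
    exact: (dhomogM (linform_homog _) (linform_homog _)).
  move=> v; rewrite mevalB mevalM !meval_linform FS meval_quadric E.
  have -> : (v *m (k *: c)) 0 0 = k * (v *m c) 0 0 by rewrite -scalemxAr mxE.
  by rewrite mulrA subrr.
by case/Firr; apply/negP/linform_nonunit.
Qed.

(* The point w completes the points of contact of l i0 and l i1 to a basis. *)
Lemma tangent_coordinates (I : finType) (l : I -> 'M[K]_3) (F : conic K)
    (i0 i1 : I) (w : 'rV[K]_3) :
  irreducible_conic F -> (forall i, tangent (l i) F) ->
  (forall i j, i != j -> ~~ (l i == l j)%MS) ->
  i0 != i1 -> w != 0 -> (w <= l i0)%MS -> (w <= l i1)%MS ->
  exists2 M : 'M[K]_3, M \in unitmx & exists2 z : I -> K * K,
    forall i j, i != j -> bracket (z i) (z j) != 0 &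
    forall i (u : 'rV_3), (u <= l i)%MS -> ell (z i) (u *m M) = 0.
Proof.
move=> Firr Ftan l_neq i01 w0 wl0 wl1.
have [S S_sym FS] := dhomog2_quadric (form_homog F).
have /fin_all_exists [x xP] i : exists x : 'rV_3,
    [/\ bil S x x = 0, x *m S != 0 & (l i == kermx (x *m S)^T)%MS].
  have [x []] := Ftan i; rewrite /on_conic /gradient FS meval_quadric.
  rewrite gradient_quadric // scaler_eq0 (negbTE two0) => xx xS.
  rewrite linearZ /= => lx; exists x; split=> //.
  have kerE : (kermx (2%:R *: (x *m S)^T) :=: kermx (x *m S)^T)%MS.
    apply/eqmxP/andP; split; rewrite sub_kermx.
      apply/eqP/(scalerI two0); rewrite scaler0 scalemxAr.
      exact: mulmx_ker.
    by rewrite -scalemxAr mulmx_ker scaler0.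
  exact/eqmxP/(eqmx_trans (eqmxP lx) kerE).
have bil_l i u : (u <= l i)%MS -> bil S u (x i) = 0.
  have [_ _ /eqmxP li] := xP i.
  by rewrite li (bil_kermx S_sym) => /eqP.
(* Orthogonal points of contact would have the same tangent. *)
have xij i j : i != j -> bil S (x i) (x j) != 0.
  move=> ij; apply: contraNneq (l_neq _ _ ij) => xx0.
  have [xi xiS /eqmxP li] := xP i; have [xj xjS /eqmxP lj] := xP j.
  have /eqmxP kij := isotropic_tangents S_sym xi xj xx0 xiS xjS.
  by apply/eqmxP; apply: eqmx_trans li _; apply: eqmx_trans kij (eqmx_sym lj).
have [x0 _ _] := xP i0; have [x1 _ _] := xP i1.
have xw0 : bil S (x i0) w = 0 by rewrite (bilC S_sym) bil_l.
have xw1 : bil S (x i1) w = 0 by rewrite (bilC S_sym) bil_l.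
have ww : bil S w w != 0.
  apply/eqP => ww.
  have split_ := isotropic_split S_sym x0 x1 xw0 xw1 (xij _ _ i01) w0 ww.
  apply: (irreducible_conic_bil FS Firr (k := 2%:R / bil S (x i0) (x i1))
    (c := S *m (x i0)^T) (d := S *m (x i1)^T)) => v.
  by rewrite split_ !mulmxA.
have [M Mu param] :=
  isotropic_param S_sym x0 x1 xw0 xw1 (xij _ _ i01) w0 ww two0.
have /fin_all_exists [z zP] i : exists z, exists2 k, k != 0 &
    forall u, bil S u (x i) = k * ell z (u *m M).
  by have [xi xiS _] := xP i; exact: param.
exists M => //; exists z => [i j ij|i u ul].
  (* If z i and z j were proportional, tangent j would pass through the point of contact [x i],
     contradicting [xij]. *)
  apply: contraNneq (xij _ _ ij) => zij.
  have [ki ki0 Ei] := zP i; have [kj kj0 Ej] := zP j.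
  rewrite Ej (ell_bracket0 (v := x j *m M) zij) ?mulr0 //.
    have [xi _ _] := xP i; move/eqP: xi.
    by rewrite Ei mulf_eq0 (negbTE ki0) => /eqP.
  have : bil S (x j) (x i) != 0 by rewrite xij // eq_sym.
  by rewrite Ei mulf_eq0 negb_or => /andP[_ h]; exact: h.
have [k k0 E] := zP i.
by have /eqP := bil_l i u ul; rewrite E mulf_eq0 (negbTE k0) => /eqP.
Qed.

(** In the coordinates u M the form has matrix [T], to which [two_triangles] applies; [mu] is
    nonzero because F is. *)
Lemma conic_two_triangles (F : conic K) (M : 'M[K]_3)
    (a b c d e f : K * K) (pab pbc pac pde pef : point K) :
  let on x y (p : point K) := ell x (p *m M) = 0 /\ ell y (p *m M) = 0 in
  M \in unitmx ->
  bracket a b != 0 -> bracket b c != 0 -> bracket a c != 0 ->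
  bracket a d != 0 -> bracket a e != 0 -> bracket a f != 0 ->
  bracket b e != 0 -> bracket c e != 0 ->
  bracket d e != 0 -> bracket e f != 0 -> bracket d f != 0 ->
  on a b pab -> on b c pbc -> on a c pac -> on d e pde -> on e f pef ->
  [/\ on_conic F pab, on_conic F pbc, on_conic F pde, on_conic F pef
    & on_conic F pac] ->
  exists2 mu, mu != 0 &
    forall x : 'rV_3, (Defs.form F).@[x 0] = mu * bezout a b c d e f (x *m M).
Proof.
move=> on Mu ab bc ac ad ae af be ce de ef df.
move=> [a1 b1] [b2 c2] [a3 c3] [d4 e4] [e5 f5].
have [S S_sym FS] := dhomog2_quadric (form_homog F).
pose T := invmx M *m S *m (invmx M)^T.
have T_sym : T^T = T by rewrite /T !trmx_mul trmxK S_sym mulmxA.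
have ST (u : 'rV_3) : bil T (u *m M) (u *m M) = bil S u u.
  rewrite /bil /T !mulmxA mulmxK // trmx_mul -!mulmxA.
  by rewrite (mulmxA (invmx M)^T) -trmx_mul mulmxV // trmx1 mul1mx.
have pM0 (p : point K) : p *m M != 0.
  apply: contraNneq (coords_neq0 p) => pM.
  by rewrite -(mulmxK Mu p) pM mul0mx.
rewrite /on_conic FS !meval_quadric -!ST => -[h1 h2 h4 h5 h3].
have [mu Tmu] := two_triangles T_sym ab bc ac ad ae af be ce de ef df
  (pM0 _) a1 b1 h1 (pM0 _) b2 c2 h2 (pM0 _) a3 c3 h3 (pM0 _) d4 e4 h4
  (pM0 _) e5 f5 h5.
have Fmu (x : 'rV_3) : (Defs.form F).@[x 0] = mu * bezout a b c d e f (x *m M).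
  by rewrite FS meval_quadric -ST Tmu.
exists mu; last by rewrite -FS.
apply: contraNneq (form_neq0 F) => mu0; apply/eqP.
by apply: (dhomog2_eq0 (form_homog F)) => v; rewrite Fmu mu0 mul0r.
Qed.

End Quadrics.

(** * The octagon and its four conics *)

Theorem corollary5p2 (R : realType) (A : 'Z_8 -> point R[i])
    (P1 P2 P3 P4 : point R[i])
    (gamma gamma1 gamma2 gamma3 gamma4 : conic R[i]) :
  octagon A ->
  is_meet P1 (line (A 1) (A 8)) (line (A 2) (A 3)) ->
  is_meet P2 (line (A 1) (A 2)) (line (A 3) (A 4)) ->
  is_meet P3 (line (A 2) (A 3)) (line (A 4) (A 5)) ->
  is_meet P4 (line (A 3) (A 4)) (line (A 5) (A 6)) ->
  [/\ on_conic gamma1 (A 1), on_conic gamma1 (A 2),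
      on_conic gamma1 (A 5), on_conic gamma1 (A 6) & on_conic gamma1 P1] ->
  [/\ on_conic gamma2 (A 2), on_conic gamma2 (A 3),
      on_conic gamma2 (A 6), on_conic gamma2 (A 7) & on_conic gamma2 P2] ->
  [/\ on_conic gamma3 (A 3), on_conic gamma3 (A 4),
      on_conic gamma3 (A 7), on_conic gamma3 (A 8) & on_conic gamma3 P3] ->
  [/\ on_conic gamma4 (A 4), on_conic gamma4 (A 5),
      on_conic gamma4 (A 8), on_conic gamma4 (A 9) & on_conic gamma4 P4] ->
  irreducible_conic gamma ->
  circumscribed A gamma ->
  exists Q : conic R[i], forall x : point R[i],
    (on_conic gamma1 x /\ on_conic gamma3 x)
      \/ (on_conic gamma2 x /\ on_conic gamma4 x) ->
    on_conic Q x.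
Proof.
set K : fieldType := R[i].
have two0 : (2%:R : K) != 0 by rewrite Num.Theory.pnatr_eq0.
move=> _ mP1 mP2 mP3 mP4 g1 g2 g3 g4 Firr [sides_neq Ftan].
have sideE n : side A n%:R = line (A n%:R) (A n.+1%:R).
  by rewrite -[in RHS]natr1.
have A1_side0 : (A 1 <= side A 0)%MS by rewrite (sideE 0) addsmxSr.
(* Sides 0 and 1 share the vertex [A 1], which serves as the third basis point. *)
have [M Mu [z z_neq zM]] :=
  tangent_coordinates two0 (i0 := 0) (i1 := 1) (w := A 1) Firr Ftan sides_neq
    isT (coords_neq0 _) A1_side0 (addsmxSl _ _).
pose on x y (p : point K) := ell x (p *m M) = 0 /\ ell y (p *m M) = 0.
have onA n : on (z n%:R) (z n.+1%:R) (A n.+1%:R).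
  by split; apply: zM; rewrite ?addsmxSl // sideE addsmxSr.
have meetP (p : point K) l m : is_meet p l m -> (p <= l)%MS /\ (p <= m)%MS.
  by case/andP; rewrite sub_capmx => /andP.
have onP (p : point K) m n :
    is_meet p (line (A m%:R) (A m.+1%:R)) (line (A n%:R) (A n.+1%:R)) ->
    on (z m%:R) (z n%:R) p.
  by rewrite -!sideE => /meetP [pm pn]; split; exact: zM.
have mod8 (n : nat) : (n + 8)%:R = n%:R :> 'Z_8.
  by apply/val_inj; rewrite /= !val_Zp_nat // modnDr.
have A9 : A 9 = A 1 by congr A; exact: (mod8 1).
have onA1 : on (z 8) (z 1) (A 1).
  by have := onA 8; rewrite A9 (_ : 9%:R = 1); last exact: (mod8 1).
have onP1 : on (z 8) (z 2) P1.
  have [P1l18 P1l23] := meetP _ _ _ mP1.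
  split; last by apply: zM; rewrite (sideE 2).
  by apply: zM; rewrite (sideE 8) A9 /line addsmxC.
have onP2 := onP _ 1 3 mP2.
have onP3 := onP _ 2 4 mP3.
have onP4 := onP _ 3 5 mP4.
(* [A 1], [A 2] and [P1] are the vertices of the triangle of sides 8, 1, 2; [A 5] and [A 6] are two
   vertices of that of sides 4, 5, 6. The other three conics follow by shifting indices. *)
have [mu1 mu10 E1] : exists2 mu, mu != 0 & forall x : 'rV_3,
    (Defs.form gamma1).@[x 0]
    = mu * bezout (z 8) (z 1) (z 2) (z 4) (z 5) (z 6) (x *m M).
  by apply: (conic_two_triangles two0 Mu _ _ _ _ _ _ _ _ _ _ _
    onA1 (onA 1) onP1 (onA 4) (onA 5) g1); apply: z_neq.
have [mu2 mu20 E2] : exists2 mu, mu != 0 & forall x : 'rV_3,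
    (Defs.form gamma2).@[x 0]
    = mu * bezout (z 1) (z 2) (z 3) (z 5) (z 6) (z 7) (x *m M).
  by apply: (conic_two_triangles two0 Mu _ _ _ _ _ _ _ _ _ _ _
    (onA 1) (onA 2) onP2 (onA 5) (onA 6) g2); apply: z_neq.
have [mu3 mu30 E3] : exists2 mu, mu != 0 & forall x : 'rV_3,
    (Defs.form gamma3).@[x 0]
    = mu * bezout (z 2) (z 3) (z 4) (z 6) (z 7) (z 8) (x *m M).
  by apply: (conic_two_triangles two0 Mu _ _ _ _ _ _ _ _ _ _ _
    (onA 2) (onA 3) onP3 (onA 6) (onA 7) g3); apply: z_neq.
have [mu4 mu40 E4] : exists2 mu, mu != 0 & forall x : 'rV_3,
    (Defs.form gamma4).@[x 0]
    = mu * bezout (z 3) (z 4) (z 5) (z 7) (z 8) (z 1) (x *m M).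
  rewrite A9 in g4.
  by apply: (conic_two_triangles two0 Mu _ _ _ _ _ _ _ _ _ _ _
    (onA 3) (onA 4) onP4 (onA 7) onA1 g4); apply: z_neq.
(* Dividing by the factors [mu1] and [mu3] turns the given forms into Bezoutians, so
   [bezout_octagon] also expresses [q] through gamma2 and gamma4. *)
pose q := (bracket (z 3) (z 7) / mu1) *: Defs.form gamma1
          + (bracket (z 5) (z 1) / mu3) *: Defs.form gamma3.
have qE (x : 'rV_3) : q.@[x 0] =
    - (bracket (z 4) (z 8) / mu2 * (Defs.form gamma2).@[x 0]
       + bracket (z 6) (z 2) / mu4 * (Defs.form gamma4).@[x 0]).
  rewrite mevalD !mevalZ E1 E2 E3 E4 !mulrA !divfK //.
  apply/eqP; rewrite -addr_eq0; apply/eqP.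
  rewrite -[RHS](bezout_octagon (z 1) (z 2) (z 3) (z 4) (z 5) (z 6) (z 7) (z 8)
    (x *m M)).
  by ring.
have q_homog : q \is 2.-homog by rewrite rpredD ?dhomogZ ?form_homog.
(* A 3 lies on gamma3 but not on gamma1. *)
have q_neq0 : q != 0.
  have qA3 : q.@[A 3 0] != 0.
    have [A32 A33] := onA 2.
    rewrite mevalD !mevalZ.
    have -> : (Defs.form gamma3).@[A 3 0] = 0 by case: g3.
    rewrite mulr0 addr0 E1 mulrA divfK //.
    apply: mulf_neq0; first exact: z_neq.
    pose V := bracket (z 8) (z 1) * bracket (z 1) (z 2) * bracket (z 8) (z 2).
    suff : V * bezout (z 8) (z 1) (z 2) (z 4) (z 5) (z 6) (A 3 *m M) != 0.
      by rewrite mulf_eq0 negb_or => /andP[].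
    have AM0 : A 3 *m M != 0.
      apply: contraNneq (coords_neq0 (A 3)) => AM.
      by rewrite -(mulmxK Mu (A 3)) AM mul0mx.
    have [k k0 kE] := ell_meet (z_neq 2 3%:R isT) AM0 A32 A33.
    (* As [A 3] is on side 2, only the product of sides 8 and 1 survives; at the pair {z 2, z 3} it
       is a nonzero scalar times nonzero brackets. *)
    rewrite /V bezout_lagrange A32 !mulr0 subrr add0r.
    rewrite kE !ellZ !ell_bipoint.
    by rewrite !mulf_neq0 // z_neq.
  by apply: contraNneq qA3 => ->; rewrite meval0.
exists (Conic q_neq0 q_homog) => x; rewrite /on_conic /=.
case=> -[h1 h2].
  by rewrite mevalD !mevalZ h1 h2 !mulr0 addr0.
by rewrite qE h1 h2 !mulr0 addr0 oppr0.
Qed.
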